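(* Let $Q(n)$ be the number of $n$-quasigroups of order $4$ on the set $A=\{0,1,2,3\}$. Then for every natural number $n\ge 1$, $$Q(n) \leq 4^{3^n} = 2^{2^{(\log_2 3)\, n+1}}.$$
   Context: Let $A=\{0,1,2,3\}$. For a natural number $n$, an $n$-quasigroup (of order $4$) is a pair $(A,q)$ where $q:A^n\to A$ satisfies $q(c)\neq q(c')$ for all $c,c'\in A^n$ that differ in exactly one coordinate. $Q(n)$ denotes the number of different $n$-quasigroups $(A,q)$, i.e. the number of such maps $q$ (not up to equivalence). *)

(* Defs.v *)
From mathcomp Require Import all_boot all_order all_algebra.
From mathcomp Require Import reals exp.

Set Implicit Arguments.
Unset Strict Implicit.
Unset Printing Implicit Defensive.

Import Order.TTheory GRing.Theory Num.Theory.

Local Open Scope ring_scope.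

Local Notation A := 'I_4.

Definition differ_in_one (n : nat) (c c' : {ffun 'I_n -> A}) : bool :=
  #|[set i | c i != c' i]| == 1%N.

(* The base set A being fixed, an n-quasigroup (A, q) is given by the map q. *)
Definition quasigroup (n : nat) (q : {ffun {ffun 'I_n -> A} -> A}) : bool :=
  [forall c, forall c', differ_in_one c c' ==> (q c != q c')].

Definition Q (n : nat) : nat :=
  #|[set q : {ffun {ffun 'I_n -> A} -> A} | quasigroup q]|.

Definition log2 (R : realType) (x : R) : R := ln x / ln 2.

(* Main.v *)
(** A quasigroup is determined by its restriction to [{0,1,2}^n]: along each
    axis-parallel line the four values form a permutation of [A], so the value
    at the last point of the line is forced by the other three. *)
Require Import Defs.
From mathcomp Require Import all_boot all_order all_algebra.
From mathcomp Require Import reals exp.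

Import Order.TTheory GRing.Theory Num.Theory.

Local Open Scope ring_scope.

Definition update {n : nat} {T : Type} (c : {ffun 'I_n -> T}) (i : 'I_n) (a : T) :
  {ffun 'I_n -> T} := [ffun j => if j == i then a else c j].

Lemma update_id {n : nat} {T : Type} (c : {ffun 'I_n -> T}) (i : 'I_n) :
  update c i (c i) = c.
Proof. by apply/ffunP => j; rewrite ffunE; case: eqP => [->|]. Qed.

Lemma quasigroup_line_inj (n : nat) (q : {ffun {ffun 'I_n -> 'I_4} -> 'I_4})
    (c : {ffun 'I_n -> 'I_4}) (i : 'I_n) :
  quasigroup q -> injective (fun a => q (update c i a)).
Proof.
move=> /forallP qq a b /eqP qab; apply/eqP; apply: contraTT qab => ab.
have /forallP /(_ (update c i b)) /implyP := qq (update c i a); apply.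
apply/cards1P; exists i; apply/setP => j.
by rewrite !inE !ffunE; case: (j == i); rewrite ?ab ?eqxx.
Qed.

(** By finiteness [f] attains the value [g x0]. A preimage other than [x0] would be a second point
    where [g] takes that value, so the preimage is [x0]. *)
Lemma inj_eq_off_point (T : finType) (f g : T -> T) (x0 : T) :
  injective f -> injective g -> (forall x, x != x0 -> f x = g x) ->
  f x0 = g x0.
Proof.
move=> f_inj g_inj fg; have [h _ hK] := injF_bij f_inj.
have [gx0|gx0] := eqVneq (h (g x0)) x0; first by rewrite -{1}gx0 hK.
by have := fg _ gx0; rewrite hK => /g_inj hx0; rewrite -hx0 eqxx in gx0.
Qed.

Definition restrict3 {n : nat} (q : {ffun {ffun 'I_n -> 'I_4} -> 'I_4}) :
    {ffun {ffun 'I_n -> 'I_3} -> 'I_4} :=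
  [ffun d : {ffun 'I_n -> 'I_3} =>
     q [ffun i => widen_ord (leqnSn 3) (d i)]].

Lemma restrict3_inj (n : nat) :
  {in [set q | quasigroup q] &, injective (@restrict3 n)}.
Proof.
move=> q q'; rewrite !inE => qq qq' /ffunP eq3; apply/ffunP => c.
(* Strong induction on the number of coordinates of [c] equal to 3. *)
have [m] := ubnP #|[set i | c i == ord_max]|.
elim: m c => // m IHm c; rewrite ltnS => cm.
have [c0|[i]] := set_0Vmem [set i | c i == ord_max].
  (* With no coordinate equal to 3, [c] lies in the restricted cube, and [inord] never falls back to
     its default value. *)
  have := eq3 [ffun i => inord (c i)]; rewrite !ffunE.
  suff -> : [ffun i => widen_ord (leqnSn 3) ([ffun i => inord (c i)] i)] = c by [].
  apply/ffunP => i; rewrite !ffunE; apply: val_inj => /=; rewrite inordK //.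
  have: i \notin [set i | c i == ord_max] by rewrite c0 inE.
  by rewrite inE -val_eqE /= => ci; rewrite ltn_neqAle ci -ltnS ltn_ord.
(* Vary coordinate [i] alone: the other three points of this line have one fewer 3, so the induction
   hypothesis gives agreement there, which forces it at [c]. *)
rewrite inE => /eqP ci; rewrite -(update_id c i) ci.
apply: (inj_eq_off_point _ (fun a => q (update c i a))
  (fun a => q' (update c i a))) => [||a a3]; try exact: quasigroup_line_inj.
apply/IHm/(leq_trans _ cm)/proper_card/properP; split.
  apply/subsetP => j; rewrite !inE !ffunE; case: (j == i) => //.
  by rewrite (negPf a3).
by exists i; rewrite inE ?ci // ffunE eqxx.
Qed.

Lemma card_quasigroups_le (n : nat) : (Q n <= 4 ^ (3 ^ n))%N.
Proof.
rewrite /Q -(card_in_imset (restrict3_inj n)); apply: leq_trans (max_card _) _.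
by rewrite !card_ffun !card_ord.
Qed.

Theorem mainTheorem6 (R : realType) (n : nat) (hn : (1 <= n)%N) :
  (Q n <= 4 ^ (3 ^ n))%N /\
  (4 ^ (3 ^ n))%N%:R = 2 `^ (2 `^ (log2 3 * n%:R + 1)) :> R.
Proof.
split; first exact: card_quasigroups_le.
have ln2 : ln (2 : R) != 0 by rewrite gt_eqF // ln_gt0 // ltr1n.
have pow_log : 2 `^ log2 3 = 3 :> R.
  by rewrite /powR pnatr_eq0 /= /log2 divfK // lnK // posrE ltr0n.
(* The exponent on the right becomes the natural number [3 ^ n * 2]; the claim is then 4 = 2 ^ 2
   raised to the power [3 ^ n]. *)
rewrite powRD; last by rewrite pnatr_eq0 implybT.
rewrite (powRrM _ (log2 3)) pow_log powRr1 ?ler0n // powR_mulrn ?ler0n //.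
rewrite -natrX -natrM powR_mulrn ?ler0n // -natrX.
by rewrite mulnC expnM.
Qed.
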